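(* $\mathsf{WWKL} \not\leq_{soc} \mathsf{RT}$. That is, weak weak König's lemma is not strongly omnisciently computably reducible to Ramsey's theorem.
   Context: A mathematical problem $\mathsf{P}$ consists of a collection of instances, each with a collection of solutions. $\mathsf{P}$ is strongly omnisciently computably reducible to $\mathsf{Q}$, written $\mathsf{P} \leq_{soc} \mathsf{Q}$, if for every $\mathsf{P}$-instance $I$ there is a $\mathsf{Q}$-instance $J$ (not required to be computable from $I$) such that every solution to $J$ computes a solution to $I$ (without access to $I$). $\mathsf{WWKL}$ (weak weak König's lemma): an instance is a binary tree $T \subseteq 2^{<\omega}$ of positive measure, meaning $\lim_s \frac{|\{\sigma \in T : |\sigma| = s\}|}{2^s} > 0$; a solution to $T$ is any infinite path through $T$. $\mathsf{RT}$ (Ramsey's theorem): an instance is a coloring $f : [\omega]^n \to k$ for some positive integers $n, k$, where $[\omega]^n$ is the collection of $n$-element subsets of $\omega$ and $k=\{0,\dots,k-1\}$; a solution to $f$ is any infinite set $H \subseteq \omega$ that is $f$-homogeneous, i.e. all $n$-element subsets of $H$ are given the same color by $f$. *)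

(* Defs.v *)
From HB Require Import structures.
From mathcomp Require Import all_boot all_order all_algebra finmap.
From mathcomp Require Import boolp classical_sets cardinality reals.
From mathcomp Require Import topology normedtype sequences.
From Stdlib Require Cantor.

Set Implicit Arguments.
Unset Strict Implicit.
Unset Printing Implicit Defensive.

Import Order.TTheory GRing.Theory Num.Theory.
Import numFieldNormedType.Exports.

(* Relative computability is given by the partial recursive functions with an
   oracle, as unary functions on [nat]; tuples are coded by the Cantor pairing
   function.  Subsets of [nat] and infinite binary sequences are both
   represented as [nat -> bool]. *)

Definition npair (x y : nat) : nat := Cantor.to_nat (x, y).
Definition nfst (n : nat) : nat := (Cantor.of_nat n).1.
Definition nsnd (n : nat) : nat := (Cantor.of_nat n).2.

Inductive code : Type :=
| CZero
| CSucc
| CFst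
| CSnd
| COracle
| CPair of code & code
| CComp of code & code
| CPrec of code & code
| CMu of code.

(* Graph of h, where h(x, 0) = a(x) and h(x, m + 1) = b(x, m, h(x, m)). *)
Fixpoint prec_graph (a b : nat -> nat -> Prop) (x m v : nat) : Prop :=
  match m with
  | 0 => a x v
  | m'.+1 => exists2 u, prec_graph a b x m' u & b (npair x (npair m' u)) v
  end.

(* [oeval g c n v]: the program [c] with oracle [g] halts on input [n] with
   output [v].  In the [CMu] case all values below the least zero must be
   defined. *)
Fixpoint oeval (g : nat -> nat) (c : code) (n v : nat) {struct c} : Prop :=
  match c with
  | CZero => v = 0
  | CSucc => v = n.+1
  | CFst => v = nfst n
  | CSnd => v = nsnd n
  | COracle => v = g n
  | CPair a b => exists x y, [/\ oeval g a n x, oeval g b n y & v = npair x y]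
  | CComp a b => exists2 u, oeval g b n u & oeval g a u v
  | CPrec a b => prec_graph (oeval g a) (oeval g b) (nfst n) (nsnd n) v
  | CMu a => oeval g a (npair n v) 0 /\
             forall i, i < v -> exists w, oeval g a (npair n i) w.+1
  end.

Lemma oeval_functional g c n v w : oeval g c n v -> oeval g c n w -> v = w.
Proof.
elim: c n v w => [||||| a IHa b IHb | a IHa b IHb | a IHa b IHb | a IHa] n v w
  /=; do ?by move=> -> ->.
- move=> [x [y [ax bY ->]]] [x' [y' [ax' bY' ->]]].
  by rewrite (IHa _ _ _ ax ax') (IHb _ _ _ bY bY').
- move=> [u bu au] [u' bu' au']; apply: IHa au _.
  by rewrite (IHb _ _ _ bu bu').
- elim: (nsnd n) v w => [|m IHm] v w /=; first exact: IHa.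
  move=> [u hu bu] [u' hu' bu']; apply: IHb bu _.
  by rewrite (IHm _ _ hu hu').
- move=> [av ltv] [aw ltw]; case: (ltngtP v w) => // [/ltw|/ltv] [z az].
  + by have := IHa _ _ _ av az.
  + by have := IHa _ _ _ aw az.
Qed.

(* [computes Y X]: X is Turing reducible to Y. *)
Definition computes (Y X : nat -> bool) : Prop :=
  exists c : code, forall n : nat, oeval (fun m => nat_of_bool (Y m)) c n (X n).

Record problem : Type := Problem {
  instance : Type;
  solution : instance -> (nat -> bool) -> Prop
}.

(* The existential on J carries no effectivity, and Y has no access to I. *)
Definition soc_reducible (P Q : problem) : Prop :=
  forall I : instance P, exists J : instance Q,
    forall Y, solution J Y -> exists2 X, solution I X & computes Y X.

Definition binary_tree (T : pred (seq bool)) : Prop :=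
  forall s t : seq bool, prefix s t -> T t -> T s.

Local Open Scope ring_scope.
Local Open Scope classical_set_scope.

Definition level_density (R : realType) (T : pred (seq bool)) (s : nat) : R :=
  #|[set sigma : s.-tuple bool | T sigma]%SET|%:R / 2 ^+ s.

Definition positive_measure (R : realType) (T : pred (seq bool)) : Prop :=
  exists2 l : R, level_density R T s @[s --> \oo] --> l & 0 < l.

Record WWKL_instance (R : realType) : Type := WWKLInstance {
  WWKL_tree : pred (seq bool);
  WWKL_treeP : binary_tree WWKL_tree;
  WWKL_measureP : positive_measure R WWKL_tree
}.

Definition path_through (T : pred (seq bool)) (X : nat -> bool) : Prop :=
  forall s : nat, T (mkseq X s).

Definition WWKL (R : realType) : problem :=
  @Problem (WWKL_instance R) (fun I X => path_through (WWKL_tree I) X).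

Local Open Scope fset_scope.

Definition nsubset (n : nat) : Type := {A : {fset nat} | #|` A| == n}.

Record RT_instance : Type := RTInstance {
  RT_exponent : nat;
  RT_colors : nat;
  RT_exponent_gt0 : (0 < RT_exponent)%N;
  RT_colors_gt0 : (0 < RT_colors)%N;
  RT_coloring : nsubset RT_exponent -> 'I_RT_colors
}.

Definition homogeneous (n k : nat) (f : nsubset n -> 'I_k) (H : nat -> bool) :
    Prop :=
  forall A B : nsubset n,
    {subset val A <= H} -> {subset val B <= H} -> f A = f B.

(* Infinitude of H makes the two ways of saying "monochromatic" (a common color,
   or any two colors agree) equivalent. *)
Definition RT : problem :=
  @Problem RT_instance (fun I H =>
    infinite_set [set x : nat | H x] /\ homogeneous (@RT_coloring I) H).

(* Main.v *)
Require Import Defs.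
From HB Require Import structures.
From mathcomp Require Import all_boot all_order all_algebra finmap.
From mathcomp Require Import boolp classical_sets cardinality reals.
From mathcomp Require Import topology normedtype sequences.

(** Fix a program [c], a finite stem [t], an infinite set [Y] and a length [n].
The condition that [c], run on [Z], outputs 1 at a given position is open in
[Z], so by the Ramsey theorem for open families (Galvin, Nash-Williams) [Y] can
be thinned out so that either all sets with stem [t] and tail in [Y] satisfy it,
or none does.  Doing this for the positions below [n] leaves a single word of
length [n] which every sequence that [c] computes from such a set must begin
with (lemma [force_prefix]).

This determines a tree.  Start with the set of all naturals and close it under
this thinning, over all [c] and [t].  The sets so obtained are indexed by finite
lists of pairs [(t, c)], hence there are countably many of them, and the length
[n] can be chosen to be [k + 2] at the list number [k].  Let the tree consist of
the words that extend none of the forced words.  It loses measure at most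
[sum_k 2 ^ (- k - 2) = 1 / 2], so it is an instance of WWKL.  The forced words,
and with them the tree, are fixed before any colouring is considered.

Inside this countable family, a diagonal intersection ([fusion]) meets every
requirement: it produces an infinite set [X] such that whatever is computed from
any infinite subset of [X] begins with a forced word, so is no path through the
tree ([exists_hard_words]).  Finally, [ramsey] gives every colouring an infinite
homogeneous set inside [X], and this solution computes no path.  The infinite
Ramsey theorem itself is another application of the open one, to the families
of sets whose first [n] elements have a given colour. *)

Set Implicit Arguments.
Unset Strict Implicit.
Unset Printing Implicit Defensive.

(** * Infinite sets and Ellentuck neighbourhoods *)

Definition unbounded (Y : nat -> bool) : Prop := forall m, exists2 n, m <= n & Y n.

(** Enlarging a set below [m] is harmless for conditions whose stem already
settles membership below [m], hence inclusion from [m] on. *)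
Definition tail_sub (m : nat) (Y' Y : nat -> bool) : Prop :=
  forall n, m <= n -> Y' n -> Y n.

(** The basic open set [[t, Y]] of the Ellentuck topology on infinite sets; the
stem is given by its characteristic word, so that it settles absences too. *)
Definition ellentuck (t : seq bool) (Y Z : nat -> bool) : Prop :=
  [/\ unbounded Z, forall i, i < size t -> Z i = nth false t i
    & tail_sub (size t) Z Y].

(** Openness for the product topology, not for the finer Ellentuck one. *)
Definition open_family (O : (nat -> bool) -> Prop) : Prop :=
  forall Z, O Z -> exists m, forall Z', (forall i, i < m -> Z' i = Z i) -> O Z'.

Lemma tail_sub_trans m A B C :
  tail_sub m A B -> tail_sub m B C -> tail_sub m A C.
Proof. by move=> AB BC i mi /(AB _ mi); apply: BC. Qed.

Lemma sub_tail m A B : subpred A B -> tail_sub m A B.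
Proof. by move=> AB n _; apply: AB. Qed.

Lemma ellentuck_tail t Y' Y Z :
  tail_sub (size t) Y' Y -> ellentuck t Y' Z -> ellentuck t Y Z.
Proof. by move=> Y'Y [uZ tZ ZY']; split=> //; apply: tail_sub_trans ZY' Y'Y. Qed.

Lemma unbounded_above Y m : unbounded Y -> unbounded (fun n => (m <= n) && Y n).
Proof.
move=> uY k; have [n kn Yn] := uY (maxn m k).
by move: kn; rewrite geq_max => /andP[mn kn]; exists n; rewrite ?mn.
Qed.

Lemma infinite_unbounded (H : nat -> bool) :
  infinite_set [set x : nat | H x]%classic <-> unbounded H.
Proof.
split=> [iH m | uH /finite_seqP[s Hs]]; last first.
  have [n ltn Hn] := uH (\max_(i <- s) i).+1.
  have : n \in s by move: Hn; rewrite -[is_true (H n)]/([set x | H x]%classic n) Hs.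
  by move=> ns; have := @leq_bigmax_seq _ s xpredT id n ns isT; rewrite leqNgt ltn.
apply: contrapT => nH; apply: iH.
apply: (@sub_finite_set _ _ `I_m); last exact: finite_II.
move=> n /= Hn; rewrite ltnNge; apply/negP => mn.
by apply: nH; exists n.
Qed.

(** * Diagonal intersection *)

(** Alternately pass to a set that meets [Q x] for the last chosen point [x], and
choose a further point of it.  The chosen points above [x] all lie in the set
that met [Q x], and [Q x] ignores what happens up to [x].  The sets are confined
to a family [M] because the theorem uses a countable one, in which
only countably many words get forced; the outcome need not belong to [M]. *)
Lemma fusion (M : (nat -> bool) -> Prop) (Q : nat -> (nat -> bool) -> Prop) :
  (forall Y, M Y -> unbounded Y) ->
  (forall x Y Y', tail_sub x.+1 Y' Y -> Q x Y -> Q x Y') ->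
  (forall x Y, M Y -> exists2 Y', M Y' & subpred Y' Y /\ Q x Y') ->
  forall Y, M Y ->
    exists X, [/\ unbounded X, subpred X Y & forall x, X x -> Q x X].
Proof.
move=> Munb Qtail Qdense Y MY.
pose state := {p : (nat -> bool) * nat | M p.1 /\ p.1 p.2}.
pose R (p q : state) := [/\ subpred (sval q).1 (sval p).1,
  Q (sval p).2 (sval q).1 & (sval p).2 < (sval q).2].
have step p : {q | R p q}.
  apply: cid; case: p => -[A a] [/= MA Aa].
  have [B MB [BA QB]] := Qdense a A MA.
  have [b ab Bb] := Munb B MB a.+1.
  by exists (exist _ (B, b) (conj MB Bb)).
have [y0 _ Yy0] := Munb Y MY 0.
pose p0 : state := exist _ (Y, y0) (conj MY Yy0).
have [f [f0 fR]] := dependent_choice step p0.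
pose Yf i := (sval (f i)).1; pose x i := (sval (f i)).2.
have Yfx i : Yf i (x i) by rewrite /Yf /x; case: (f i) => p [].
have Yf_le i j : i <= j -> subpred (Yf j) (Yf i).
  move=> /subnK <-; elim: (j - i) => [//|k IHk] n.
  by have [sub _ _] := fR (k + i); move=> /sub /IHk.
have x_lt : {homo x : i j / i < j}.
  by apply: homo_ltn => [a b c|i]; [exact: ltn_trans | case: (fR i)].
have x_ge i : i <= x i.
  by elim: i => // i IHi; apply: leq_ltn_trans IHi (x_lt _ _ (ltnSn i)).
exists (fun n => `[< exists i, x i = n >]); split.
- by move=> m; exists (x m) => //; apply/asboolP; exists m.
- move=> n /asboolP[i <-]; have -> : Y = Yf 0 by rewrite /Yf f0.
  exact: Yf_le (Yfx i).
- move=> n /asboolP[i <-]; apply: (Qtail _ (Yf i.+1)); last by case: (fR i).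
  move=> m xim /asboolP[j xj]; move: xim; rewrite -xj => xij.
  apply: (Yf_le _ j) (Yfx j); rewrite ltnNge; apply/negP => ji.
  move: xij; rewrite ltnNge; case/negP.
  by case: (ltngtP j i) ji => [/x_lt/ltnW||->].
Qed.

Lemma meet_requirements (M : (nat -> bool) -> Prop) (I : eqType)
    (P : I -> (nat -> bool) -> Prop) :
  (forall i Y Y', subpred Y' Y -> P i Y -> P i Y') ->
  (forall i Y, M Y -> exists2 Y', M Y' & subpred Y' Y /\ P i Y') ->
  forall (s : seq I) Y, M Y ->
    exists2 Y', M Y' & subpred Y' Y /\ forall i, i \in s -> P i Y'.
Proof.
move=> Psub Pdense; elim=> [|i s IHs] Y MY; first by exists Y => //; split.
have [A MA [AY PA]] := IHs Y MY; have [B MB [BA PB]] := Pdense i A MA.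
exists B => //; split=> [n /BA /AY //|j].
by rewrite inE => /orP[/eqP->|/PA] //; apply: Psub.
Qed.

(** * The Ramsey theorem for open families *)

Definition words (n : nat) : seq (seq bool) :=
  [seq val t | t <- enum {: n.-tuple bool}].

Lemma mem_words (t : seq bool) : t \in words (size t).
Proof. by apply/mapP; exists (in_tuple t) => //; rewrite mem_enum. Qed.

(** Combinatorial forcing of Nash-Williams and Galvin. *)
Definition accepts (O : (nat -> bool) -> Prop) (t : seq bool) (Y : nat -> bool) :
  Prop := forall Z, ellentuck t Y Z -> O Z.

Definition rejects (O : (nat -> bool) -> Prop) (t : seq bool) (Y : nat -> bool) :
  Prop :=
  forall Y', unbounded Y' -> tail_sub (size t) Y' Y -> ~ accepts O t Y'.

Definition decides O t Y := accepts O t Y \/ rejects O t Y.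

(** The stem of the set obtained by adding to the set of stem [t] the point [y]
as its new maximum. *)
Definition add_point (t : seq bool) (y : nat) : seq bool :=
  mkseq (fun i => nth false t i || (i == y)) y.+1.

Lemma decides_tail O t Y Y' :
  tail_sub (size t) Y' Y -> decides O t Y -> decides O t Y'.
Proof.
move=> Y'Y [acc|rej]; [left=> Z Z_Y' | right=> A uA AY'].
  exact/acc/(ellentuck_tail Y'Y).
by apply: rej => //; apply: tail_sub_trans AY' Y'Y.
Qed.

Lemma decides_dense O t (Y : nat -> bool) : unbounded Y ->
  exists2 Y', unbounded Y' & subpred Y' Y /\ decides O t Y'.
Proof.
move=> uY; have [rej|] := pselect (rejects O t Y).
  by exists Y => //; split=> //; right.
move=> /existsNP[A /not_implyP[uA /not_implyP[AY /contrapT acc]]].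
exists (fun n => (size t <= n) && A n); first exact: unbounded_above.
split=> [n /andP[tn An]|]; first exact: AY.
left=> Z ZA; apply: acc; apply: ellentuck_tail ZA.
by move=> n _ /andP[].
Qed.

(** If the one-point extensions of [t] by infinitely many [y] were accepted, the
set of these [y] would accept [t]: a set [Z] with stem [t] and tail among them
extends the stem obtained by adding its first point beyond [t]. *)
Lemma accepts_bounded O t (Y : nat -> bool) :
  (forall u y, Y y -> size u = y.+1 -> decides O u Y) -> rejects O t Y ->
  exists m, forall y, m <= y -> Y y -> rejects O (add_point t y) Y.
Proof.
move=> dec rej; apply: contrapT => /forallNP nb.
pose A y := [&& Y y, size t <= y & `[< accepts O (add_point t y) Y >]].
apply: (rej A) => [m | y _ /andP[] // | Z [uZ tZ ZA]].
  have /existsNP[y /not_implyP[my /not_implyP[Yy nrej]]] :=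
    nb (maxn m (size t)).
  move: my; rewrite geq_max => /andP[my ty]; exists y => //.
  rewrite /A Yy ty /=; apply/asboolP.
  by case: (dec (add_point t y) y Yy); rewrite ?size_mkseq.
have exZ : exists y, (size t <= y) && Z y.
  by have [y ty Zy] := uZ (size t); exists y; rewrite ty.
have [y /andP[ty Zy] ymin] := ex_minnP exZ.
have /and3P[_ _ /asboolP acc] := ZA y ty Zy.
apply: acc; split=> //; rewrite size_mkseq; last first.
  by move=> n yn /ZA; rewrite (leq_trans ty (ltnW yn)) => /(_ isT)/and3P[].
move=> i iy; rewrite nth_mkseq //.
have [it|ti] := ltnP i (size t).
  by rewrite tZ // ltn_eqF ?orbF // (leq_trans it).
rewrite nth_default //=; have [->//|ne] := eqVneq i y.
apply/negbTE/negP => Zi; have := ymin i; rewrite ti Zi => /(_ isT).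
by rewrite leqNgt ltn_neqAle ne -ltnS iy.
Qed.

(** If no thinning accepts [t], fuse twice: to a set [B] that decides all stems
ending in it, then to a [D] along which rejection is inherited by
one-point extensions.  All initial segments of a [Z] in [[t, D]] are then
rejected; but if [Z] were in [O], openness would make one of them accepted. *)
Theorem open_ramsey O t Y : open_family O -> unbounded Y ->
  exists2 Y', unbounded Y' &
    subpred Y' Y /\ (accepts O t Y' \/ accepts (fun Z => ~ O Z) t Y').
Proof.
move=> openO uY.
have [A uA [AY dA]] := decides_dense O t uY.
have [acc|rej] := dA; first by exists A => //; split=> //; left.
have [B [uB BA decB]] :
    exists B, [/\ unbounded B, subpred B A & forall x, B x ->
      forall u, u \in words x.+1 -> decides O u B].
  apply: (fusion (M := unbounded)
    (Q := fun x X => forall u, u \in words x.+1 -> decides O u X)) => //.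
    move=> x X X' X'X dX u ux; apply: decides_tail (dX u ux).
    by move: ux => /mapP[v _ ->]; rewrite size_tuple.
  move=> x X uX; apply: meet_requirements (words x.+1) X uX.
    by move=> u X1 X2 /(@sub_tail (size u)); apply: decides_tail.
  by move=> u X1; apply: decides_dense.
have {}decB u y : B y -> size u = y.+1 -> decides O u B.
  by move=> By uy; apply: (decB y) => //; rewrite -uy mem_words.
have rejB : rejects O t B.
  by move=> C uC CB; apply: rej => //; apply: tail_sub_trans CB (sub_tail BA).
have thin u X : unbounded X -> exists2 X', unbounded X' & subpred X' X /\
    (rejects O u B -> forall y, X' y -> B y -> rejects O (add_point u y) B).
  move=> uX; have [rejuB|nrej] := pselect (rejects O u B); last by exists X => //; split.
  have [m Hm] := accepts_bounded decB rejuB.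
  exists (fun n => (m <= n) && X n); first exact: unbounded_above.
  by split=> [n /andP[]//|_ y /andP[my _]]; apply: Hm.
have [C uC [CB rejC]] := thin t B uB.
have [D [uD DC rejD]] :
    exists D, [/\ unbounded D, subpred D C & forall x, D x ->
      forall u, u \in words x.+1 -> rejects O u B ->
      forall y, x < y -> D y -> B y -> rejects O (add_point u y) B].
  apply: (fusion (M := unbounded) (Q := fun x X =>
    forall u, u \in words x.+1 -> rejects O u B ->
      forall y, x < y -> X y -> B y -> rejects O (add_point u y) B)) => //.
    by move=> x X X' X'X rX u ux ru y xy X'y; apply: (rX u ux ru y xy (X'X y xy X'y)).
  move=> x X uX.
  have [X' uX' [X'X rX']] : exists2 X', unbounded X' & subpred X' X /\
      forall u, u \in words x.+1 -> rejects O u B ->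
        forall y, X' y -> B y -> rejects O (add_point u y) B.
    apply: (@meet_requirements _ _ (fun u X => rejects O u B ->
      forall y, X y -> B y -> rejects O (add_point u y) B)) uX => //.
    by move=> u X1 X2 X21 rX ru y /X21; apply: rX.
  by exists X' => //; split=> // u ux ru y _; apply: rX'.
exists D => //; split; first by move=> n /DC /CB /BA /AY.
right=> Z [uZ tZ ZD] OZ.
(* Points are added one at a time; positions outside [Z] leave the stem of
   [add_point] unchanged, so the induction runs over all lengths [m]. *)
have rejZ m : size t <= m ->
    forall y, m <= y -> D y -> rejects O (add_point (mkseq Z m) y) B.
  move/subnK <-; elim: (m - size t) => [|k IHk] y; rewrite ?add0n ?addSn => my Dy.
    have -> : add_point (mkseq Z (size t)) y = add_point t y.
      apply: eq_mkseq => i; congr (_ || _).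
      have [it|ti] := ltnP i (size t); first by rewrite nth_mkseq ?tZ.
      by rewrite !nth_default ?size_mkseq.
    by apply: rejC => //; [apply: DC | apply/CB/DC].
  have [Zm|nZm] := boolP (Z (k + size t)); last first.
    have -> : add_point (mkseq Z (k + size t).+1) y
            = add_point (mkseq Z (k + size t)) y.
      apply: eq_mkseq => i; congr (_ || _).
      have [ilt|] := ltnP i (k + size t).
        by rewrite !nth_mkseq // ltnW.
      rewrite leq_eqVlt => /orP[/eqP<-|lti].
        by rewrite nth_mkseq // nth_default ?size_mkseq // (negbTE nZm).
      by rewrite !nth_default ?size_mkseq // ltnW.
    by apply: IHk => //; apply: ltnW.
  have Dm : D (k + size t) by apply: ZD; rewrite ?leq_addl.
  apply: (rejD _ Dm) => //; last 1 first.
  - by apply/CB/DC.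
  - by rewrite -{2}(size_mkseq Z (k + size t).+1) mem_words.
  have <- : add_point (mkseq Z (k + size t)) (k + size t)
            = mkseq Z (k + size t).+1.
    apply/eq_in_map => i; rewrite mem_iota /= add0n ltnS leq_eqVlt.
    case/orP=> [/eqP->|ilt]; first by rewrite eqxx orbT Zm.
    by rewrite nth_mkseq // ltn_eqF // orbF.
  exact: IHk.
have [m Om] := openO Z OZ; have [z mz Zz] := uZ (maxn m (size t)).
move: mz; rewrite geq_max => /andP[mz tz].
have Dz : D z by apply: ZD.
apply: (rejZ z tz z (leqnn z) Dz B uB) => //.
move=> W [_ WZ _]; apply: Om => i im.
have iz : i <= z by apply: ltnW (leq_trans im mz).
rewrite WZ ?size_mkseq ?ltnS // nth_mkseq // nth_mkseq ?(leq_trans im) //.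
by rewrite ltn_eqF ?orbF // (leq_trans im).
Qed.

(** * Forcing the initial segment of a computed sequence *)

(** The use principle: a halting computation queries finitely many values. *)
Lemma oeval_use g c n v : oeval g c n v ->
  exists m, forall g', (forall i, i < m -> g' i = g i) -> oeval g' c n v.
Proof.
elim: c n v => [||||| a IHa b IHb | a IHa b IHb | a IHa b IHb | a IHa] n v /=;
  do ?by move=> ->; exists 0.
- by move=> ->; exists n.+1 => g' ->.
- move=> [x [y [/IHa[p ap] /IHb[q bq] ->]]]; exists (maxn p q) => g' gg'.
  exists x, y; split=> //; [apply: ap|apply: bq] => i lti; apply: gg';
  by rewrite leq_max lti ?orbT.
- move=> [u /IHb[q bq] /IHa[p ap]]; exists (maxn p q) => g' gg'.
  by exists u; [apply: bq|apply: ap] => i lti; apply: gg';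
    rewrite leq_max lti ?orbT.
- elim: (nsnd n) v => [|m IHm] v /=; first exact: IHa.
  move=> [u /IHm[q hq] /IHb[p bp]]; exists (maxn p q) => g' gg'.
  by exists u; [apply: hq|apply: bp] => i lti; apply: gg';
    rewrite leq_max lti ?orbT.
- move=> [/IHa[p ap] below].
  have [q bq] : exists q, forall g', (forall i, i < q -> g' i = g i) ->
      forall i, i < v -> exists w, oeval g' a (npair n i) w.+1.
    elim: v below {ap} => [|v IHv] below; first by exists 0.
    have [|q bq] := IHv; first by move=> i iv; apply: below; apply: ltnW.
    have [w /IHa[r ar]] := below v (ltnSn v); exists (maxn q r) => g' gg' i.
    rewrite ltnS leq_eqVlt => /orP[/eqP->|iv].
      by exists w; apply: ar => j lti; apply: gg'; rewrite leq_max lti orbT.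
    by apply: bq => // j lti; apply: gg'; rewrite leq_max lti.
  exists (maxn p q) => g' gg'; split; [apply: ap|apply: bq] => i lti; apply: gg';
  by rewrite leq_max lti ?orbT.
Qed.

Definition computes_with (c : code) (Y X : nat -> bool) : Prop :=
  forall n, oeval (fun m => nat_of_bool (Y m)) c n (X n).

(** Each bit is decided by [open_ramsey]: if no oracle in the neighbourhood makes
[c] output 1 at [n], the only bit that [c] can output there is 0. *)
Lemma force_prefix c t n Y : unbounded Y ->
  exists s Y', [/\ size s = n, unbounded Y', subpred Y' Y
    & forall Z X, ellentuck t Y' Z -> computes_with c Z X -> mkseq X n = s].
Proof.
move=> uY; elim: n => [|n [s [Y1 [ss uY1 Y1Y forced]]]].
  by exists [::], Y; split.
pose O Z := oeval (fun m => nat_of_bool (Z m)) c n 1.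
have openO : open_family O.
  move=> Z /oeval_use[m use]; exists m => Z' Z'Z; apply: use => i im.
  by rewrite Z'Z.
have [Y2 uY2 [Y21 hom]] := open_ramsey t openO uY1.
have [b Hb] : exists b, forall Z X, ellentuck t Y2 Z -> computes_with c Z X ->
    X n = b.
  case: hom => HO; [exists true|exists false] => Z X NZ cX.
    by have := oeval_functional (cX n) (HO Z NZ); case: (X n).
  by apply/negbTE/negP => Xn; apply: (HO Z NZ); rewrite /O; have := cX n; rewrite Xn.
exists (rcons s b), Y2; split=> //; first by rewrite size_rcons ss.
  by move=> i /Y21/Y1Y.
move=> Z X NZ cX; rewrite -(addn1 n) /mkseq iotaD map_cat /= add0n cats1.
congr rcons; last exact: Hb cX.
by apply: forced cX; apply: ellentuck_tail NZ; apply: sub_tail.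
Qed.

(** * Countability of the programs *)

Fixpoint code_tree (c : code) : GenTree.tree nat :=
  match c with
  | CZero => GenTree.Leaf 0
  | CSucc => GenTree.Leaf 1
  | CFst => GenTree.Leaf 2
  | CSnd => GenTree.Leaf 3
  | COracle => GenTree.Leaf 4
  | CPair a b => GenTree.Node 0 [:: code_tree a; code_tree b]
  | CComp a b => GenTree.Node 1 [:: code_tree a; code_tree b]
  | CPrec a b => GenTree.Node 2 [:: code_tree a; code_tree b]
  | CMu a => GenTree.Node 3 [:: code_tree a]
  end.

Fixpoint tree_code (u : GenTree.tree nat) : option code :=
  match u with
  | GenTree.Leaf 0 => Some CZero
  | GenTree.Leaf 1 => Some CSucc
  | GenTree.Leaf 2 => Some CFst
  | GenTree.Leaf 3 => Some CSnd
  | GenTree.Leaf 4 => Some COracle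
  | GenTree.Node k [:: a; b] =>
    if tree_code a is Some a' then
      if tree_code b is Some b' then
        match k with
        | 0 => Some (CPair a' b')
        | 1 => Some (CComp a' b')
        | 2 => Some (CPrec a' b')
        | _ => None
        end
      else None
    else None
  | GenTree.Node 3 [:: a] => omap CMu (tree_code a)
  | _ => None
  end.

Lemma code_treeK : pcancel code_tree tree_code.
Proof. by elim=> //= [a -> b ->|a -> b ->|a -> b ->|a ->]. Qed.

HB.instance Definition _ := Countable.copy code (pcan_type code_treeK).

(** * Trees of positive measure avoiding given words *)

(** Only the words of index below the length are inspected, which suffices since
the [k]th word will have length [k + 2]. *)
Definition avoiding_tree (w : nat -> seq bool) : pred (seq bool) :=
  fun s => all (fun k => ~~ prefix (w k) s) (iota 0 (size s)).

Lemma avoiding_tree_binary w : binary_tree (avoiding_tree w).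
Proof.
move=> s t st /allP Tt; apply/allP => k; rewrite mem_iota /= add0n => ks.
apply: contra (Tt k _) => [ws|]; first exact: prefix_trans ws st.
by rewrite mem_iota /= add0n (leq_trans ks) // size_prefix.
Qed.

Lemma path_avoids w X k :
  size (w k) = k.+2 -> path_through (avoiding_tree w) X -> mkseq X k.+2 <> w k.
Proof.
move=> wk pX Xw; have /allP/(_ k) := pX k.+2.
by rewrite size_mkseq mem_iota add0n leq0n ltnW // Xw prefix_refl => /(_ isT).
Qed.

Lemma card_prefix (u : seq bool) s :
  #|[set t : s.-tuple bool | prefix u t]%SET| <=
    if size u <= s then 2 ^ (s - size u) else 0.
Proof.
case: (leqP (size u) s) => us; last first.
  rewrite leqn0 cards_eq0; apply/eqP/setP => t; rewrite !inE.
  by apply/negbTE/negP => /size_prefix; rewrite size_tuple leqNgt us.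
rewrite -card_bool -card_tuple.
rewrite -(card_in_imset (f := fun t : s.-tuple bool => drop_tuple (size u) t)).
  exact: max_card.
move=> t1 t2; rewrite !inE !prefixE => /eqP t1u /eqP t2u /(congr1 val) /= d12.
apply: val_inj; rewrite /= -[LHS](cat_take_drop (size u)) t1u d12 -{1}t2u.
by rewrite cat_take_drop.
Qed.

Lemma card_union_bound (T : finType) (I : Type) (r : seq I) (B : I -> {set T})
    (A : {set T}) :
  (forall x, x \in A -> has (fun i => x \in B i) r) ->
  #|A| <= \sum_(i <- r) #|B i|.
Proof.
elim: r A => [|i r IHr] A covA.
  rewrite big_nil leqn0 cards_eq0; apply/eqP/setP => x; rewrite inE.
  by apply/negbTE/negP => /covA.
rewrite big_cons -(cardsID (B i) A) leq_add //.
  by apply: subset_leq_card; apply: subsetIr.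
by apply: IHr => x; rewrite inE => /andP[xBi /covA /=]; rewrite (negbTE xBi).
Qed.

(** The excluded words of index [k] make up at most a fraction [2 ^ (- k - 2)] of
a level, hence at most half of it in total. *)
Lemma card_avoiding_tree w s : (forall k, size (w k) = k.+2) ->
  2 ^ s <= 2 * #|[set t : s.-tuple bool | avoiding_tree w t]%SET|.
Proof.
move=> ws; set A := [set t : _ | _]%SET.
have bad : #|~: A| <=
    \sum_(k <- iota 0 s) #|[set t : s.-tuple bool | prefix (w k) t]%SET|.
  apply: card_union_bound => t; rewrite !inE /avoiding_tree size_tuple.
  by rewrite -has_predC => /hasP[k ks /= /negPn wt]; apply/hasP; exists k; rewrite ?inE.
have geom n : n <= s ->
    2 * (\sum_(k <- iota 0 n) #|[set t : s.-tuple bool | prefix (w k) t]%SET|)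
      + 2 ^ (s - n) <= 2 ^ s.
  (* The extra term [2 ^ (s - n)] is the tail of the geometric series. *)
  elim: n => [|n IHn] ns; first by rewrite big_nil subn0.
  rewrite -[in iota _ _]addn1 iotaD big_cat big_seq1 /= add0n.
  apply: leq_trans (IHn (ltnW ns)); rewrite mulnDr -addnA leq_add2l.
  have := card_prefix (w n) s; rewrite ws => wn.
  rewrite -(subnSK ns) expnS [leqRHS]mul2n -addnn leq_add2r.
  apply: leq_trans (leq_mul (leqnn 2) wn) _.
  by case: (ltnP n.+1 s) => ns'; rewrite ?muln0 // -expnS subnSK.
have cA : #|A| + #|~: A| = 2 ^ s by rewrite cardsC card_tuple card_bool.
have bad2 : 2 * #|~: A| <= 2 ^ s.
  apply: leq_trans (leq_mul (leqnn 2) bad) _.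
  by apply: (leq_trans (leq_addr _ _) (geom s (leqnn s))).
by rewrite -(leq_add2r (2 * #|~: A|)) -mulnDr cA [leqRHS]mul2n -addnn leq_add2l.
Qed.

Lemma card_level_succ (T : pred (seq bool)) s : binary_tree T ->
  #|[set t : s.+1.-tuple bool | T t]%SET| <= 2 * #|[set t : s.-tuple bool | T t]%SET|.
Proof.
move=> treeT; set A := [set t : s.-tuple bool | T t]%SET.
apply: (@leq_trans (\sum_(u <- enum A) #|[set t : s.+1.-tuple bool | prefix u t]%SET|)).
  apply: card_union_bound => t; rewrite inE => Tt.
  have st : size (take s t) == s by rewrite size_take size_tuple ltnSn.
  apply/hasP; exists (Tuple st); last by rewrite inE prefix_take.
  by rewrite mem_enum inE; apply: treeT Tt; apply: prefix_take.
rewrite mulnC cardE -sum1_size big_distrl /=; apply: leq_sum => u _.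
by have := card_prefix u s.+1; rewrite size_tuple leqnSn subSnn mul1n.
Qed.

Import Order.TTheory GRing.Theory Num.Theory.
Import numFieldNormedType.Exports.

(** The densities of the levels of a tree never increase, so they converge. *)
Lemma positive_measure_of_bound (R : realType) (T : pred (seq bool)) :
  binary_tree T ->
  (forall s, 2 ^ s <= 2 * #|[set t : s.-tuple bool | T t]%SET|) ->
  positive_measure R T.
Proof.
move=> treeT boundT.
have dens_ge s : (2^-1 <= level_density R T s)%R.
  rewrite /level_density ler_pdivlMr ?exprn_gt0 // mulrC ler_pdivrMr //.
  by rewrite -natrX -natrM ler_nat mulnC.
have dens_dec : {homo level_density R T : m n / m <= n >-> (n <= m)%R}.
  apply: homo_leq => [x|y x z xy yz|s]; [exact: lexx|exact: le_trans yz xy|].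
  rewrite /level_density ler_pdivrMr ?exprn_gt0 // exprS mulrCA.
  rewrite divfK ?expf_neq0 ?pnatr_eq0 //.
  by rewrite -natrM ler_nat card_level_succ.
have cv : cvgn (level_density R T).
  by apply: nonincreasing_is_cvgn => //; exists 2^-1%R => _ [s _ <-].
exists (limn (level_density R T)); first exact: cv.
apply: (@lt_le_trans _ _ 2^-1%R); first by rewrite invr_gt0.
by apply: limr_ge => //; apply: nearW.
Qed.

(** * The infinite Ramsey theorem *)

Definition initial_segment (A : {fset nat}) (Z : nat -> bool) : Prop :=
  {subset A <= Z} /\ forall a z, a \in A -> Z z -> z <= a -> z \in A.

Lemma initial_segment_inj (A B : {fset nat}) Z :
  initial_segment A Z -> initial_segment B Z -> #|` A| = #|` B| -> A = B.
Proof.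
have half (C D : {fset nat}) : initial_segment C Z -> initial_segment D Z ->
    #|` C| = #|` D| -> (C `<=` D)%fset.
  move=> [CZ Cdown] [DZ Ddown] cCD; apply/fsubsetP => c cC.
  apply: contrapT => /negP cD.
  have DC : (D `<=` C)%fset.
    apply/fsubsetP => d dD; apply: (Cdown c d) => //; first exact: DZ.
    rewrite leqNgt; apply/negP => cd; case/negP: cD.
    exact: Ddown dD (CZ c cC) (ltnW cd).
  have /eqP DCeq : D == C by rewrite eqEfcard DC cCD leqnn.
  by rewrite DCeq cC in cD.
by move=> iA iB cAB; apply/eqP; rewrite eqEfsubset !half.
Qed.

Lemma fset_le_bigmax (A : {fset nat}) a : a \in A -> a <= \max_(b <- A) b.
Proof. by move=> aA; exact: (@leq_bigmax_seq _ (enum_fset A) xpredT id). Qed.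

Definition initial_color (n k : nat) (f : nsubset n -> 'I_k) (c : 'I_k)
    (Z : nat -> bool) : Prop :=
  exists2 A : nsubset n, initial_segment (val A) Z & f A = c.

Lemma open_initial_color n k (f : nsubset n -> 'I_k) c :
  open_family (initial_color f c).
Proof.
move=> Z [A [AZ Adown] fA]; exists (\max_(a <- val A) a).+1 => Z' Z'Z.
exists A => //; split=> [a aA | a z aA Z'z za].
  by rewrite -topredE /= Z'Z ?ltnS ?fset_le_bigmax //; apply: AZ.
apply: (Adown a z aA _ za); rewrite -Z'Z // ltnS.
exact: leq_trans za (fset_le_bigmax aA).
Qed.

(** Thin out so that, for each colour, all infinite subsets or none have their
first [n] points of that colour.  The colour of an [n]-subset [A] of [H] occurs,
since [A] is an initial segment of some infinite subset of [H]; so it is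
also the colour of the first [n] points of [H]. *)
Theorem ramsey n k (f : nsubset n -> 'I_k) Y : unbounded Y ->
  exists2 H, unbounded H & subpred H Y /\ homogeneous f H.
Proof.
move=> uY.
have [H uH [HY mono]] : exists2 H, unbounded H & subpred H Y /\
    forall c, c \in enum 'I_k -> accepts (initial_color f c) [::] H \/
      accepts (fun Z => ~ initial_color f c Z) [::] H.
  apply: (@meet_requirements _ _ (fun c X =>
    accepts (initial_color f c) [::] X \/
    accepts (fun Z => ~ initial_color f c Z) [::] X)) uY.
    move=> c X X' X'X [] acc; [left|right] => Z NZ; apply: acc;
    by apply: ellentuck_tail NZ; apply: sub_tail.
  by move=> c X uX; apply: open_ramsey => //; apply: open_initial_color.
exists H => //; split=> //.
have colorH A : {subset val A <= H} -> initial_color f (f A) H.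
  move=> AH; pose Z y := (y \in val A) || (H y && all (fun a => a < y) (val A)).
  have NZ : ellentuck [::] H Z.
    split=> // [m|y _ /orP[/AH|/andP[]]//].
    have [y ymax Hy] := uH (maxn m (\max_(a <- val A) a).+1).
    move: ymax; rewrite geq_max => /andP[my ltAy]; exists y => //.
    apply/orP; right; rewrite Hy; apply/allP => a aA.
    by apply: leq_ltn_trans ltAy; exact: fset_le_bigmax.
  have AZ : initial_color f (f A) Z.
    exists A => //; split=> [a aA|a z aA /orP[//|/andP[_ /allP/(_ a aA)]]].
      by rewrite -topredE /= /Z aA.
    by rewrite ltnNge => /negP.
  have [acc|/(_ Z NZ)//] := mono (f A) (mem_enum _ _).
  by apply: acc; split.
move=> A B /colorH[A' iA' <-] /colorH[B' iB' <-]; congr f.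
apply/val_inj/(initial_segment_inj iA' iB').
by rewrite (eqP (valP A')) (eqP (valP B')).
Qed.

(** * A tree none of whose paths is computed from subsets of a fixed set *)

(** The [k]th word has length [k + 2] so that the words exclude total measure at
most one half.  The words [w] form the prefixes forced at the countably many sets
reached by iterated thinning, and [X] is a fusion of such sets. *)
Lemma exists_hard_words : exists2 w : nat -> seq bool,
  forall k, size (w k) = k.+2
  & exists2 X, unbounded X & forall c Z W, unbounded Z -> subpred Z X ->
      computes_with c Z W -> exists k, mkseq W k.+2 = w k.
Proof.
have /choice[g gP] : forall p : (nat -> bool) * (seq bool * code) * nat,
    exists q : seq bool * (nat -> bool), unbounded p.1.1 ->
      [/\ size q.1 = p.2, unbounded q.2, subpred q.2 p.1.1
        & forall Z W, ellentuck p.1.2.1 q.2 Z -> computes_with p.1.2.2 Z W ->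
            mkseq W p.2 = q.1].
  move=> [[Y [t c]] n] /=; have [uY|nuY] := pselect (unbounded Y).
    by have [s [Y' ?]] := force_prefix c t n uY; exists (s, Y').
  by exists ([::], Y).
pose len (i : seq (seq bool * code)) := (choice.pickle i).+2.
(* [F i] is the word forced, and the set reached, after serving the pairs
   listed in [i], the head of the list being the last one served.  The empty list
   serves none, and its word is arbitrary. *)
pose F := fix F (i : seq (seq bool * code)) := if i is j :: i'
  then g ((F i').2, j, len i) else (nseq (len [::]) false, xpredT).
have uF i : unbounded (F i).2.
  elim: i => [m|j i IHi]; first by exists m.
  by case: (gP ((F i).2, j, len (j :: i)) IHi).
have sF i : size (F i).1 = len i.
  case: i => [|j i]; first by rewrite size_nseq.
  by case: (gP ((F i).2, j, len (j :: i)) (uF i)).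
pose w (k : nat) := if @pickle_inv (seq (seq bool * code)) k is Some i
  then (F i).1 else nseq k.+2 false.
have wF i : w (choice.pickle i) = (F i).1 by rewrite /w pickleK_inv.
exists w.
  move=> k; rewrite /w; have := @pickle_invK (seq (seq bool * code)) k.
  by case: pickle_inv => [i /= ik|_]; rewrite ?sF ?size_nseq // /len ik.
pose meets (j : seq bool * code) (X : nat -> bool) :=
  forall Z W, ellentuck j.1 X Z -> computes_with j.2 Z W ->
    exists k, mkseq W k.+2 = w k.
(* At the point [x] only the programs numbered up to [x] are served; an infinite
   [Z] has points [x] beyond the number of any given program. *)
pose reqs x : seq (seq bool * code) :=
  [seq (t, c) | t <- words x.+1, c <- pmap choice.unpickle (iota 0 x.+1)].
have [X [uX _ QX]] : exists X, [/\ unbounded X, subpred X xpredT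
    & forall x, X x -> forall j : seq bool * code, j \in reqs x -> meets j X].
  apply: (@fusion (fun Y => exists i, Y = (F i).2)
    (fun x X => forall j : seq bool * code, j \in reqs x -> meets j X));
    last by exists [::].
  - by move=> _ [i ->].
  - move=> x Y Y' Y'Y mY j jx Z W NZ; apply: (mY j jx).
    apply: ellentuck_tail NZ.
    by case/allpairsP: jx => -[t c] [/mapP[u _ ->] _ ->] /=; rewrite size_tuple.
  - move=> x Y MY; apply: (@meet_requirements _ _ meets) MY.
      move=> j Y1 Y2 Y21 mY Z W NZ; apply: mY.
      by apply: ellentuck_tail NZ; apply: sub_tail.
    move=> j _ [i ->]; exists (F (j :: i)).2; first by exists (j :: i).
    have [_ _ sub forced] := gP ((F i).2, j, len (j :: i)) (uF i).
    split=> // Z W NZ cW; exists (choice.pickle (j :: i)).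
    by rewrite wF -(forced Z W NZ cW).
exists X => // c Z W uZ ZX cW.
have [x cx Zx] := uZ (choice.pickle c).
apply: (QX x (ZX x Zx) (mkseq Z x.+1, c) _ Z W _ cW).
  apply: allpairs_f; first by rewrite -{2}(size_mkseq Z x.+1) mem_words.
  rewrite mem_pmap; apply/mapP; exists (choice.pickle c); last by rewrite choice.pickleK.
  by rewrite mem_iota /= add0n ltnS.
split=> //; last exact: sub_tail.
by move=> i; rewrite [size _]size_mkseq => ix; rewrite nth_mkseq.
Qed.

(** * The separation *)

Theorem corollary2p7 (R : realType) : ~ soc_reducible (WWKL R) RT.
Proof.
have [w sw [X uX hard]] := exists_hard_words.
have treeT := @avoiding_tree_binary w.
move=> /(_ (WWKLInstance treeT (positive_measure_of_bound R treeT
  (fun s => card_avoiding_tree s sw))))[[n k n_gt0 k_gt0 f] red].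
have [H uH [HX homH]] := ramsey f uX.
have [|W pathW [c cW]] := red H; first by split; first exact/infinite_unbounded.
have [i Wi] := hard c H W uH HX cW.
exact: path_avoids (sw i) pathW Wi.
Qed.
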